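(* For all integers $m,n\geq 0$, $$2I^m_n-m^n=I^{m+1}_n,$$ with the convention $0^0=1$.
   Context: Let $X_n=\{1,\dots,n\}$. A preferential arrangement of a finite set is an ordered set partition: a linearly ordered sequence of pairwise disjoint nonempty subsets (blocks) whose union is the set. A restricted barred preferential arrangement of $X_n$ with $m$ bars is a sequence of $m+1$ sections $S_1,\dots,S_{m+1}$, where the $S_i$ are pairwise disjoint, possibly empty, subsets with union $X_n$, such that each of the first $m$ sections $S_1,\dots,S_m$ consists of at most one block (it is either empty or a single block containing all its elements), while the last section $S_{m+1}$ (the free section) carries an arbitrary preferential arrangement of its elements (possibly empty, possibly with several blocks). $I^m_n$ denotes the number of restricted barred preferential arrangements of $X_n$ with $m$ bars; in particular $I^0_n$ is the number of preferential arrangements of $X_n$. *)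

(* Defs.v *)
From mathcomp Require Import all_boot all_order all_algebra.

Set Implicit Arguments.
Unset Strict Implicit.
Unset Printing Implicit Defensive.

Definition pref_arrangement (T : finType) (A : {set T}) (s : seq {set T}) :
    bool :=
  [&& set0 \notin s,
      pairwise (fun B C : {set T} => [disjoint B & C]) s
    & \bigcup_(B <- s) B == A].

(* By this lemma, the bound on the number of blocks in the bounded sequences
   used below excludes no arrangement. *)
Lemma size_pref_arrangement (T : finType) (A : {set T}) (s : seq {set T}) :
  pref_arrangement A s -> size s <= #|A|.
Proof.
elim: s A => [|B s IHs] A //= /and3P[].
rewrite inE negb_or /= => /andP[B0 s0] /andP[/allP dB ds] /eqP <-.
rewrite big_cons cardsU.
have -> : B :&: \bigcup_(C <- s) C = set0.
  apply/eqP; rewrite setI_eq0 bigcup_seq.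
  by apply/bigcup_disjointP => C /dB.
rewrite cards0 subn0 -add1n leq_add //; first by rewrite card_gt0 eq_sym.
by apply: IHs; rewrite /pref_arrangement s0 ds eqxx.
Qed.

(* X_n is represented by 'I_n and the sections S_1, ..., S_{m+1} by
   S 0, ..., S m, so that the free section is S m; b i is the sequence of
   blocks of section i. *)
Definition restricted_barred (m n : nat) (S : {ffun 'I_m.+1 -> {set 'I_n}})
    (b : {ffun 'I_m.+1 -> n.-bseq {set 'I_n}}) : bool :=
  [&& [forall i, forall j, (i != j) ==> [disjoint S i & S j]],
      \bigcup_i S i == [set: 'I_n],
      [forall i, pref_arrangement (S i) (b i)]
    & [forall i : 'I_m.+1, (i < m) ==> (size (b i) <= 1)]].

(* The number I^m_n. *)
Definition nb_restricted_barred (m n : nat) : nat :=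
  #|[set p : {ffun 'I_m.+1 -> {set 'I_n}} *
             {ffun 'I_m.+1 -> n.-bseq {set 'I_n}}
     | restricted_barred p.1 p.2]|.

(* Main.v *)
(* Let P(A) be the number of preferential arrangements of A.  Choosing the free
   section A first and then distributing the remaining elements among the m
   other sections gives I^m_n = \sum_A m^(n - |A|) P(A).  Removing the first
   block shows that P(A) is the sum of P(B) over the proper subsets B of A when
   A is nonempty, so that the sum of P(B) over all subsets B of A is 2 P(A),
   or 2 P(A) - 1 if A is empty.  Since (m+1)^(n - |B|) is the sum of
   m^(n - |A|) over the A containing B, exchanging sums yields
   I^(m+1)_n = 2 I^m_n - m^n, the correction being the term A = set0. *)
Require Import Defs.
From mathcomp Require Import all_boot all_order all_algebra.

Lemma pref_arrangement_nil (T : finType) (A : {set T}) :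
  pref_arrangement A [::] = (A == set0).
Proof. by rewrite /pref_arrangement big_nil /= eq_sym. Qed.

(** Disjointness of [B] from each later block is disjointness from their union, which must then be
    exactly what [B] leaves of [A]. *)
Lemma pref_arrangement_cons (T : finType) (A B : {set T}) (s : seq {set T}) :
  pref_arrangement A (B :: s) =
  [&& B != set0, B \subset A & pref_arrangement (A :\: B) s].
Proof.
rewrite /pref_arrangement inE negb_or big_cons /= eq_sym.
set U := \bigcup_(C <- s) C.
have -> : all (fun C : {set T} => [disjoint B & C]) s = [disjoint B & U].
  rewrite /U bigcup_seq.
  by apply/allP/bigcup_disjointP => dB C /dB.
have cover : [disjoint B & U] && (B :|: U == A)
    = (B \subset A) && (U == A :\: B).
  apply/andP/andP=> [[dBU /eqP<-]|[sBA /eqP->]].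
    rewrite subsetUl setDUl setDv set0U eq_sym; split=> //.
    by apply/eqP/setDidPl; rewrite disjoint_sym.
  have -> : B :|: A :\: B = A by rewrite -{1}(setIidPr sBA) setID.
  split=> //.
  by rewrite disjoint_sym -setI_eq0 setDE -setIA (setIC (~: B)) setICr setI0.
rewrite -!andbA (andbCA (B \subset A)) (andbCA (B \subset A)) -cover.
by do !bool_congr.
Qed.

(* The bound n on the number of blocks is harmless as soon as #|A| <= n. *)
Definition nb_pref_arrangement (T : finType) (n : nat) (A : {set T}) : nat :=
  #|[pred s : n.-bseq {set T} | pref_arrangement A s]|.

Lemma nb_pref_arrangement0 (T : finType) (n : nat) :
  nb_pref_arrangement T n set0 = 1.
Proof.
rewrite /nb_pref_arrangement -(card1 ([bseq] : n.-bseq {set T})).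
apply: eq_card => s; rewrite !inE -val_eqE /=; case: (val s) => [|B t].
  by rewrite pref_arrangement_nil !eqxx.
rewrite pref_arrangement_cons subset0.
by case: (B =P set0).
Qed.

Lemma nb_pref_arrangement_rec (T : finType) (n : nat) (A : {set T}) :
  #|T| <= n -> A != set0 ->
  nb_pref_arrangement T n A = \sum_(B : {set T} | B \proper A) nb_pref_arrangement T n B.
Proof.
move=> leTn A0; rewrite /nb_pref_arrangement -sum1_card.
(* Arrangements are classified by what remains after the first block. The default of [head] never
   matters: [A] is nonempty, so it has no empty arrangement. *)
rewrite (partition_big (fun s : n.-bseq {set T} => A :\: head set0 s)
  (fun B : {set T} => B \proper A)) /=; last first.
  move=> s; rewrite inE; case: (val s) => [|B t] /=.
    by rewrite pref_arrangement_nil (negPf A0).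
  rewrite pref_arrangement_cons => /and3P[B0 sBA _].
  rewrite properE subsetDl; apply: contra B0 => sAAB.
  have := subset_trans sBA sAAB.
  by rewrite subsetD => /andP[_]; rewrite -setI_eq0 setIid.
apply: eq_bigr => B sBA; rewrite -sum1_card.
(* [h] puts the removed block back and [h'] drops it. The length bound survives since
   [size t <= #|B| < #|A| <= n] whenever [t] arranges [B]. *)
pose h (t : n.-bseq {set T}) := insub_bseq n (A :\: B :: t).
pose h' (s : n.-bseq {set T}) := insub_bseq n (behead s).
have hE (t : n.-bseq {set T}) :
    pref_arrangement B t -> h t = A :\: B :: t :> seq _.
  move=> /size_pref_arrangement tB; rewrite insubdK // -topredE /=.
  by rewrite (leq_ltn_trans tB) // (leq_trans (proper_card sBA)) //
    (leq_trans (max_card _)).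
have h'E (s : n.-bseq {set T}) : h' s = behead s :> seq _.
  rewrite insubdK // -topredE /= size_behead.
  by rewrite (leq_trans (leq_pred _)) ?size_bseq.
have sub := proper_sub sBA.
have AABE : A :\: (A :\: B) = B by rewrite setDDr setDv set0U; apply/setIidPr.
have headE (s : n.-bseq {set T}) :
    pref_arrangement A s -> A :\: head set0 s = B ->
    exists2 t, s = A :\: B :: t :> seq _ & pref_arrangement B t.
  case: s => -[|C t] /= _.
    by rewrite pref_arrangement_nil (negPf A0).
  rewrite pref_arrangement_cons => /and3P[_ sCA tB] CB; exists t; last first.
    by rewrite -CB.
  by rewrite -CB setDDr setDv set0U (setIidPr sCA).
rewrite (reindex_onto h h') => [|s /andP[/headE hs /eqP/hs[t st tB]]]; last first.
  by apply: val_inj; rewrite /= hE h'E st.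
apply: eq_bigl => t; rewrite !inE.
apply/idP/idP=> [/andP[/andP[/headE ht /eqP/ht[u Eu uB]] /eqP<-]|tB].
  by rewrite h'E Eu.
rewrite hE //= pref_arrangement_cons AABE tB eqxx subsetDl !andbT.
rewrite setD_eq0 (proper_subn sBA) /=.
by apply/eqP/val_inj; rewrite /= h'E hE.
Qed.

Lemma sum_subset_nb_pref_arrangement (T : finType) (n : nat) (A : {set T}) :
  #|T| <= n ->
  \sum_(B : {set T} | B \subset A) nb_pref_arrangement T n B + (A == set0) =
  2 * nb_pref_arrangement T n A.
Proof.
move=> leTn; rewrite (bigD1 A) //=.
have -> : \sum_(B : {set T} | (B \subset A) && (B != A)) nb_pref_arrangement T n B
    = \sum_(B : {set T} | B \proper A) nb_pref_arrangement T n B.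
  by apply: eq_bigl => B; rewrite properEneq andbC.
have [->|A0] := eqVneq A set0.
  rewrite nb_pref_arrangement0 big1 // => B.
  by rewrite properE subset0 => /andP[/eqP->]; rewrite sub0set.
by rewrite -nb_pref_arrangement_rec // addn0 mul2n addnn.
Qed.

(** Binomial expansion: in the product of the [1 + (x \notin A) * m], let [B] be the set of points
    where the summand 1 is chosen. A point of [A] outside [B] contributes a factor 0, so only
    supersets of [A] survive. *)
Lemma sum_supset_exp (T : finType) (m : nat) (A : {set T}) :
  \sum_(B : {set T} | A \subset B) m ^ #|~: B| = m.+1 ^ #|~: A|.
Proof.
transitivity (\prod_x (1 + (x \notin A) * m)); last first.
  rewrite -prod_nat_const [RHS]big_mkcond; apply: eq_bigr => x _.
  by rewrite inE; case: (x \in A); rewrite ?mul1n.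
rewrite bigA_distr [RHS](bigID (fun B : {set T} => A \subset B)) /=.
rewrite [X in _ + X]big1.
  rewrite addn0; apply: eq_bigr => B sAB.
  rewrite -prod_nat_const big_mkcond; apply: eq_bigr => x _.
  rewrite inE; have [//|xB] := boolP (x \in B).
  by rewrite (contra (subsetP sAB x)) ?mul1n.
by move=> B /subsetPn[x xA xB]; rewrite (bigD1 x) //= (negPf xB) xA.
Qed.

(** A restricted section leaves no freedom once its set is fixed: its sequence of blocks is [[::]]
    or [[:: A]], according to whether [A] is empty. *)
Lemma card_at_most_one_block (T : finType) (n : nat) (A : {set T}) :
  #|T| <= n ->
  #|[pred s : n.-bseq {set T} | pref_arrangement A s && (size s <= 1)]| = 1.
Proof.
move=> leTn; set s0 := insub_bseq n (if A == set0 then [::] else [:: A]).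
have s0E : s0 = (if A == set0 then [::] else [:: A]) :> seq _.
  rewrite insubdK // -topredE /=; have [//|A0] := eqVneq A set0.
  by rewrite /= (leq_trans _ leTn) // (leq_trans _ (max_card (mem A))) ?card_gt0.
rewrite -[RHS](card1 s0); apply: eq_card => s; rewrite !inE -val_eqE /= s0E.
case: (val s) => [|B [|C t]].
- by rewrite pref_arrangement_nil; case: (A == set0).
- rewrite pref_arrangement_cons pref_arrangement_nil setD_eq0 /= andbT.
  rewrite -eqEsubset; have [->|A0] := eqVneq A set0.
    by rewrite andNb.
  rewrite eqseq_cons andbT; have [->|_] := eqVneq B A; last by rewrite andbF.
  by rewrite A0.
by rewrite andbF; case: (A == set0); rewrite ?eqseq_cons ?andbF.
Qed.

Definition disjoint_cover (I T : finType) (S : {ffun I -> {set T}}) : bool :=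
  [forall i, forall j, (i != j) ==> [disjoint S i & S j]]
  && (\bigcup_i S i == [set: T]).

(* A family of pairwise disjoint sets covering T is the family of fibres of a
   unique function from T to I. *)
Lemma card_disjoint_cover (I T : finType) (k : I) (A : {set T}) :
  #|[pred S : {ffun I -> {set T}} | disjoint_cover I T S & S k == A]|
  = #|I|.-1 ^ #|~: A|.
Proof.
pose g (f : {ffun T -> I}) : {ffun I -> {set T}} :=
  [ffun i => [set x | f x == i]].
have g_inj : injective g.
  move=> f1 f2 /ffunP e; apply/ffunP => x.
  by have /setP/(_ x) := e (f1 x); rewrite !ffunE !inE eqxx => /esym/eqP.
(* The fibre over [k] is [A] exactly when points of [A] go to [k] and all others avoid it, which
   leaves [#|I|.-1] values for each of the latter. *)
pose F x := if x \in A then pred1 k else predC1 k.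
transitivity #|family F|; last first.
  rewrite card_family foldrE big_map big_enum /=.
  rewrite (bigID (fun x => x \in A)) /= big1 ?mul1n; last first.
    by move=> x xA; rewrite /F xA card1.
  rewrite -prod_nat_const; apply: eq_big => x; first by rewrite inE.
  by move=> xA; rewrite /F (negPf xA) -(cardC1 k).
rewrite -(card_image g_inj); apply: eq_card => S; rewrite !inE.
apply/idP/imageP => [/andP[/andP[/forallP dS /eqP cS] /eqP SkA]|[f fF ->]].
  have ex x : exists i, x \in S i.
    have : x \in \bigcup_i S i by rewrite cS inE.
    by case/bigcupP=> i _; exists i.
  pose f := [ffun x => xchoose (ex x)].
  have fS x i : (x \in S i) = (f x == i).
    rewrite ffunE; have xS := xchooseP (ex x).
    apply/idP/eqP=> [xi|<- //]; apply/eqP; apply: contraTT xi => ne.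
    have /forallP/(_ i)/implyP/(_ ne) := dS (xchoose (ex x)).
    by move/disjointFr->.
  exists f; last by apply/ffunP=> i; apply/setP=> x; rewrite ffunE inE fS.
  by apply/familyP => x; rewrite /F -SkA fS; case: ifP; rewrite inE => ->.
apply/andP; split; last first.
  apply/eqP/setP => x; rewrite ffunE inE.
  by have := familyP fF x; rewrite /F; case: ifP => _; rewrite inE //= => /negPf.
apply/andP; split.
  apply/forallP=> i; apply/forallP=> j; apply/implyP => ne.
  rewrite -setI_eq0; apply/eqP/setP => x; rewrite !ffunE !inE.
  by case: eqP => // ->; rewrite (negPf ne).
apply/eqP/setP => x; rewrite inE; apply/bigcupP; exists (f x) => //.
by rewrite ffunE inE.
Qed.

Lemma nb_restricted_barredE (m n : nat) :
  nb_restricted_barred m n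
  = \sum_(A : {set 'I_n}) m ^ #|~: A| * nb_pref_arrangement _ n A.
Proof.
have leTn : #|'I_n| <= n by rewrite card_ord.
rewrite /nb_restricted_barred -sum1dep_card.
(* For fixed sections [S], the block sequences are chosen independently, each from its own [Q S i],
   so their number is a product over [i]. *)
pose Q (S : {ffun 'I_m.+1 -> {set 'I_n}}) i :=
  [pred s : n.-bseq {set 'I_n} |
    pref_arrangement (S i) s && ((i < m) ==> (size s <= 1))].
rewrite (eq_bigl (fun p => disjoint_cover _ _ p.1 && (p.2 \in family (Q p.1)))).
  rewrite -(pair_big_dep _ (fun S b => b \in family (Q S)) (fun _ _ => 1)) /=.
  rewrite (partition_big (fun S : {ffun 'I_m.+1 -> {set 'I_n}} => S ord_max)
    predT) //=.
  apply: eq_bigr => A _.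
  have := card_disjoint_cover _ _ (ord_max : 'I_m.+1) A.
  rewrite card_ord /= => <-; rewrite -sum_nat_const.
  apply: eq_bigr => S /andP[_ /eqP <-].
  rewrite sum1_card card_family foldrE big_map big_enum /= big_ord_recr /=.
  rewrite big1 ?mul1n => [|i _].
    by apply: eq_card => s; rewrite [LHS]unfold_in inE /= ltnn andbT.
  rewrite -[RHS](card_at_most_one_block _ n (S (widen_ord (leqnSn m) i)) leTn).
  by apply: eq_card => s; rewrite [LHS]unfold_in inE /= ltn_ord.
move=> [S b] /=; rewrite /restricted_barred /disjoint_cover -andbA.
congr [&& _, _ & _].
apply/andP/familyP=> [[/forallP h1 /forallP h2] i|h].
  by rewrite inE h1 h2.
by split; apply/forallP=> i; have := h i; rewrite inE => /andP[].
Qed.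

Theorem theorem3 (m n : nat) :
  (2 * (nb_restricted_barred m n)%:Z - m%:Z ^+ n
   = (nb_restricted_barred m.+1 n)%:Z)%R.
Proof.
suff E : nb_restricted_barred m.+1 n + m ^ n = 2 * nb_restricted_barred m n.
  apply/eqP; rewrite GRing.subr_eq; apply/eqP.
  by rewrite -PoszM -E PoszD -!natz GRing.natrX.
have leTn : #|'I_n| <= n by rewrite card_ord.
rewrite !nb_restricted_barredE big_distrr /=.
transitivity (\sum_(A : {set 'I_n}) (m ^ #|~: A| *
  (\sum_(B : {set 'I_n} | B \subset A) nb_pref_arrangement 'I_n n B + (A == set0)))).
  under [RHS]eq_bigr => A _ do rewrite mulnDr big_distrr /=.
  (* The double sum gives the count for [m.+1] bars; in the correction only [A = set0] survives,
     giving [m ^ n]. *)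
  rewrite big_split /= (exchange_big_dep predT) //=; congr (_ + _).
    by apply: eq_bigr => A _; rewrite -sum_supset_exp big_distrl.
  rewrite (bigD1 set0) //= eqxx muln1 setC0 cardsT card_ord big1 ?addn0 //.
  by move=> A /negPf->; rewrite muln0.
apply: eq_bigr => A _.
by rewrite sum_subset_nb_pref_arrangement // mulnCA.
Qed.
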